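(* For every route $R$, let $\mathcal{X}_{=}(R)=\{x\in\mathcal{X}\cap\mathbb{Z}^E: R\in\mathcal{R}(x)\}$ and let $W(x;\mathcal{X}_{=}(R))=(\alpha^R)^Tx+\beta^R$ be an activation function with respect to $\mathcal{X}_{=}(R)$. Consider the family of ILS cuts $$\mathcal{C}_R=\{(\Omega(R),\mathcal{X}_{=}(R),\mathcal{Q}(R),\alpha^R,\beta^R): R\text{ is a route}\},$$ and let $$\mathcal{F}_R=\{(x,\theta)\in(\mathcal{X}\cap\mathbb{Z}^E)\times\mathbb{R}^\Omega_+:\theta(\Omega(R))\ge\mathcal{Q}(R)\cdot((\alpha^R)^Tx+\beta^R)\ \text{for every route }R\}.$$ Then $\mathrm{epi}(\mathcal{Q},\mathcal{X})=\mathrm{proj}_{(x,\rho)}(\mathcal{F}_R)$ if and only if the disaggregation of $\mathcal{Q}$ is route-disjoint.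
   Context: Setting. $G=(V,E)$ is a complete undirected graph with $V=\{0\}\,\dot\cup\,V_+$, where $0$ is the depot and $V_+$ is the finite set of customers. For $S\subseteq V$, $E(S)$ is the set of edges with both endpoints in $S$ and $\delta(S)$ the set of edges with exactly one endpoint in $S$ ($\delta(v)=\delta(\{v\})$). For a vector $f$ and a set $H$ of coordinates, $f(H)=\sum_{i\in H}f_i$. A route is a simple cycle through the depot, written $R=(v_1,\dots,v_\ell)$ with $\ell\ge1$ and distinct customers $v_i$, with edges $0v_1,v_1v_2,\dots,v_\ell0$ (edge $0v_1$ taken with multiplicity 2 if $\ell=1$); a sequence and its reversal are the same route. $V_+(R)=\{v_1,\dots,v_\ell\}$, and $\mathbb{1}_R\in\mathbb{Z}^E$ is the characteristic vector of the edge (multi)set of $R$. A routing plan is a set of routes whose customer sets partition $V_+$. Let $$\mathcal{X}_{\mathrm{sub}}=\{x\in[0,2]^E : x(\delta(v))=2\ \forall v\in V_+,\ x(E(S))\le|S|-1\ \forall\,\emptyset\ne S\subseteq V_+\}.$$ Integer vectors $x\in\mathcal{X}_{\mathrm{sub}}$ are in bijection with routing plans; $\mathcal{R}(x)$ denotes the unique routing plan with $x=\sum_{R\in\mathcal{R}(x)}\mathbb{1}_R$. Fix a polytope $\mathcal{X}\subseteq\mathcal{X}_{\mathrm{sub}}$. A recourse function $\mathcal{Q}$ (fixed) assigns to each route $R$ a value $\mathcal{Q}(R)\in\mathbb{Q}_+$; for $x\in\mathcal{X}\cap\mathbb{Z}^E$, $\mathcal{Q}(x)=\sum_{R\in\mathcal{R}(x)}\mathcal{Q}(R)$.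 Define $\mathrm{epi}(\mathcal{Q},\mathcal{X})=\{(x,\rho): \rho\ge\mathcal{Q}(x),\ x\in\mathcal{X}\cap\mathbb{Z}^E\}$. Disaggregation. $\Omega$ is a fixed nonempty finite set, and a disaggregation of $\mathcal{Q}$ along $\Omega$ is fixed: values $\mathcal{Q}(R,\omega)\in\mathbb{Q}_+$ for every route $R$ and $\omega\in\Omega$ with $\mathcal{Q}(R)=\sum_{\omega\in\Omega}\mathcal{Q}(R,\omega)$ for every $\bar x\in\mathcal{X}\cap\mathbb{Z}^E$ and $R\in\mathcal{R}(\bar x)$. $\Omega(R)=\{\omega\in\Omega:\mathcal{Q}(R,\omega)>0\}$. The disaggregation is route-disjoint if for every $\bar x\in\mathcal{X}\cap\mathbb{Z}^E$ and distinct routes $R,R'\in\mathcal{R}(\bar x)$ we have $\Omega(R)\cap\Omega(R')=\emptyset$. For $P\subseteq\mathbb{R}^E\times\mathbb{R}^\Omega$, $\mathrm{proj}_{(x,\rho)}(P)=\{(x,\rho):\rho=\mathbf{1}^T\theta,\ (x,\theta)\in P\}$, where $\mathbf{1}$ is the all-ones vector. ILS cuts. For $\mathcal{X}'\subseteq\mathcal{X}\cap\mathbb{Z}^E$, an activation function with respect to $\mathcal{X}'$ is an affine function $W(\cdot;\mathcal{X}'):\mathbb{R}^E\to\mathbb{R}$ with $W(x;\mathcal{X}')=1$ for $x\in\mathcal{X}'$ and $W(x;\mathcal{X}')\le0$ for $x\in(\mathcal{X}\cap\mathbb{Z}^E)\setminus\mathcal{X}'$. A number $L\in\mathbb{Q}_+$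 is a recourse lower bound with respect to $U\subseteq\Omega$ and $\mathcal{X}'$ if $\sum_{\omega\in U}\sum_{R\in\mathcal{R}(\bar x)}\mathcal{Q}(R,\omega)\ge L$ for all $\bar x\in\mathcal{X}'$. A family of ILS cuts is a set of tuples $(U,\mathcal{X}',L,\alpha,\beta)$ with $U\subseteq\Omega$, $\mathcal{X}'\subseteq\mathcal{X}\cap\mathbb{Z}^E$, $L$ a recourse lower bound with respect to $U$ and $\mathcal{X}'$, and $x\mapsto\alpha^Tx+\beta$ an activation function with respect to $\mathcal{X}'$; the tuple represents the inequality $\theta(U)\ge L\cdot(\alpha^Tx+\beta)$. *)

(* Defs.v *)
From HB Require Import structures.
From mathcomp Require Import all_boot all_order all_algebra.
From mathcomp Require Import boolp classical_sets reals.

Set Implicit Arguments.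
Unset Strict Implicit.
Unset Printing Implicit Defensive.

Import Order.TTheory GRing.Theory Num.Theory.

Local Open Scope classical_set_scope.
Local Open Scope ring_scope.
Local Open Scope quotient_scope.

(** Vertices are [option C] for a finite type [C] of customers: [None] is the
    depot and [Some v] is the customer [v].  Edges of the complete undirected
    graph are the two-element sets of vertices. *)
Notation edge C := {e : {set (option C)} | #|e| == 2%N}.

(** [E(S)] *)
Definition inner_edges (C : finType) (S : {set option C}) : {set edge C} :=
  [set e : edge C | val e \subset S].

(** [delta(S)] *)
Definition boundary (C : finType) (S : {set option C}) : {set edge C} :=
  [set e : edge C | #|val e :&: S| == 1%N].

(** The size bound carried by [bseq] is no restriction on duplicate-free
    sequences; it makes the type finite. *)
Notation cust_seq C := {s : {bseq #|C| of C} | uniq s && (0 < size s)%N}.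

Definition cust_list (C : finType) (s : cust_seq C) : seq C := val (val s).

Definition same_route (C : finType) : rel (cust_seq C) := fun s t =>
  (cust_list s == cust_list t) || (cust_list s == rev (cust_list t)).

Lemma same_route_refl (C : finType) : reflexive (@same_route C).
Proof. by move=> s; rewrite /same_route eqxx. Qed.

Lemma same_route_sym (C : finType) : symmetric (@same_route C).
Proof.
move=> s t; apply/idP/idP; rewrite /same_route => /orP[] /eqP->;
  by rewrite ?revK eqxx ?orbT.
Qed.

Lemma same_route_trans (C : finType) : transitive (@same_route C).
Proof.
move=> t s u; rewrite /same_route.
by move=> /orP[] /eqP-> /orP[] /eqP->; rewrite ?revK eqxx ?orbT.
Qed.

Canonical same_route_equiv (C : finType) :=
  EquivRel (@same_route C) (@same_route_refl C) (@same_route_sym C)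
           (@same_route_trans C).

(** A sequence and its reversal are the same route. *)
Definition route (C : finType) : Type := {eq_quot @same_route C}.

HB.instance Definition _ (C : finType) := EqQuotient.on (route C).
HB.instance Definition _ (C : finType) := Countable.on (route C).
HB.instance Definition _ (C : finType) :=
  isFinite.Build (route C) (pcan_enumP (can_pcan (@reprK _ (route C)))).

(** Customer sequence of a representative; the notions below do not depend on
    the representative ([route_customersE], [route_multE]). *)
Definition route_seq (C : finType) (r : route C) : seq C := cust_list (repr r).

(** [V_+(R)] *)
Definition route_customers (C : finType) (r : route C) : {set C} :=
  [set v in route_seq r].

(** Edges of the closed walk [0 v_1 ... v_l 0]; for [l = 1] the edge [0 v_1]
    occurs twice. *)
Definition seq_edges (C : finType) (s : seq C) : seq {set option C} :=
  let c := None :: map Some s in [seq [set p.1; p.2]%SET | p <- zip c (rot 1 c)].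

(** Entry at [e] of the characteristic vector of the edge multiset of [r]. *)
Definition route_mult (C : finType) (r : route C) (e : edge C) : nat :=
  count_mem (val e) (seq_edges (route_seq r)).

Lemma seq_edges_rev (C : finType) (s : seq C) :
  seq_edges (rev s) = rev (seq_edges s).
Proof.
rewrite /seq_edges !rot1_cons.
have -> : None :: map Some (rev s) = rev (rcons (map Some s) None).
  by rewrite rev_rcons map_rev.
have -> : rcons (map Some (rev s)) None = rev (None :: map Some s).
  by rewrite rev_cons map_rev.
set c := None :: _; set c' := rcons _ _.
have eq_sz : size c' = size c by rewrite /= size_rcons size_map.
rewrite -rev_zip // map_rev; congr rev.
elim: c' c eq_sz => [|x c' IH] [|y c] //= [/IH ->].
by rewrite finset.setUC.
Qed.

Lemma route_seqP (C : finType) (s : cust_seq C) :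
  route_seq (\pi_(route C) s) = cust_list s \/
  route_seq (\pi_(route C) s) = rev (cust_list s).
Proof.
have : same_route (repr (\pi_(route C) s)) s by rewrite -eqmodE reprK.
by case/orP => /eqP; [left | right].
Qed.

Lemma route_customersE (C : finType) (s : cust_seq C) :
  route_customers (\pi_(route C) s) = [set v in cust_list s].
Proof.
apply/setP => v; rewrite !inE.
by case: (route_seqP s) => ->; rewrite ?mem_rev.
Qed.

Lemma route_multE (C : finType) (s : cust_seq C) (e : edge C) :
  route_mult (\pi_(route C) s) e = count_mem (val e) (seq_edges (cust_list s)).
Proof.
rewrite /route_mult.
by case: (route_seqP s) => ->; rewrite ?seq_edges_rev ?count_rev.
Qed.

(** A set of routes whose customer sets partition the customers.  Stated on the
    routes themselves, since distinct routes may have the same customer set. *)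
Definition routing_plan (C : finType) (P : {set route C}) : bool :=
  [forall v : C, #|[set r in P | v \in route_customers r]| == 1%N].

Notation vec R C := {ffun edge C -> R}.

Definition dot (R : realType) (C : finType) (a x : vec R C) : R :=
  \sum_e a e * x e.

(** [f(H)] *)
Definition total (R : realType) (I : finType) (f : {ffun I -> R})
  (H : {set I}) : R := \sum_(i in H) f i.

Definition Xsub (R : realType) (C : finType) : set (vec R C) :=
  [set x : vec R C | [/\ forall e, 0 <= x e <= 2,
               forall v : C, total x (boundary [set Some v]%SET) = 2
             & forall S : {set option C}, S != finset.set0 -> None \notin S ->
                 total x (inner_edges S) <= #|S|%:R - 1]].

(** Convex hull of finitely many points; [n = 0] gives the empty polytope. *)
Definition polytope (R : realType) (C : finType) (X : set (vec R C)) : Prop :=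
  exists (n : nat) (p : 'I_n -> vec R C),
    X = [set x : vec R C | exists lam : 'I_n -> R,
          [/\ forall i, 0 <= lam i, \sum_i lam i = 1
            & forall e, x e = \sum_i lam i * p i e]].

Definition int_points (R : realType) (C : finType) (X : set (vec R C)) :
  set (vec R C) := [set x : vec R C | X x /\ forall e, x e \is a Num.int].

Definition plan_vec (R : realType) (C : finType) (P : {set route C}) : vec R C :=
  [ffun e => \sum_(r in P) (route_mult r e)%:R].

(** The routing plan with characteristic vector [x].  It exists and is unique
    for integer points of [Xsub]; elsewhere the value is irrelevant. *)
Definition plan_of (R : realType) (C : finType) (x : vec R C) : {set route C} :=
  odflt finset.set0
    [pick P : {set route C} | routing_plan P && (x == plan_vec R P)].

Definition recourse_function (C : finType) (Q : route C -> rat) : Prop :=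
  forall r, 0 <= Q r.

Definition recourse (R : realType) (C : finType) (Q : route C -> rat)
  (x : vec R C) : rat := \sum_(r in plan_of x) Q r.

Definition epi (R : realType) (C : finType) (Q : route C -> rat)
  (X : set (vec R C)) : set (vec R C * R) :=
  [set z : vec R C * R | ratr (recourse Q z.1) <= z.2 /\ int_points X z.1].

Definition disaggregation (R : realType) (C Om : finType) (X : set (vec R C))
  (Q : route C -> rat) (q : route C -> Om -> rat) : Prop :=
  (forall r w, 0 <= q r w) /\
  (forall x r, int_points X x -> r \in plan_of x -> Q r = \sum_w q r w).

(** [Omega(R)] *)
Definition scen (C Om : finType) (q : route C -> Om -> rat) (r : route C) :
  {set Om} := [set w | 0 < q r w].

Definition route_disjoint (R : realType) (C Om : finType) (X : set (vec R C))
  (q : route C -> Om -> rat) : Prop :=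
  forall x, int_points X x ->
    forall r r', r \in plan_of x -> r' \in plan_of x -> r != r' ->
      scen q r :&: scen q r' = finset.set0.

Definition proj_rho (R : realType) (C Om : finType)
  (P : set (vec R C * {ffun Om -> R})) : set (vec R C * R) :=
  [set z : vec R C * R | exists2 th : {ffun Om -> R}, z.2 = \sum_w th w & P (z.1, th)].

(** [x |-> dot alpha x + beta] is an activation function with respect to [X'],
    a set of integer points of [X]. *)
Definition activation (R : realType) (C : finType) (X X' : set (vec R C))
  (alpha : vec R C) (beta : R) : Prop :=
  (forall x, X' x -> dot alpha x + beta = 1) /\
  (forall x, int_points X x -> ~ X' x -> dot alpha x + beta <= 0).

Definition recourse_lower_bound (R : realType) (C Om : finType)
  (q : route C -> Om -> rat) (U : {set Om}) (X' : set (vec R C)) (L : rat) :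
  Prop :=
  0 <= L /\
  forall x, X' x -> L <= \sum_(w in U) \sum_(r in plan_of x) q r w.

Record ils_tuple (R : realType) (C Om : finType) := ILS {
  ils_scen : {set Om};
  ils_pts : set (vec R C);
  ils_bound : rat;
  ils_alpha : vec R C;
  ils_beta : R }.

Definition is_ils_cut (R : realType) (C Om : finType) (X : set (vec R C))
  (q : route C -> Om -> rat) (c : ils_tuple R C Om) : Prop :=
  [/\ ils_pts c `<=` int_points X,
      recourse_lower_bound q (ils_scen c) (ils_pts c) (ils_bound c)
    & activation X (ils_pts c) (ils_alpha c) (ils_beta c)].

Definition satisfies_ils (R : realType) (C Om : finType)
  (c : ils_tuple R C Om) (x : vec R C) (th : {ffun Om -> R}) : Prop :=
  ratr (ils_bound c) * (dot (ils_alpha c) x + ils_beta c)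
    <= total th (ils_scen c).

(** [X_=(R)] *)
Definition X_eq (R : realType) (C : finType) (X : set (vec R C)) (r : route C) :
  set (vec R C) := [set x : vec R C | int_points X x /\ r \in plan_of x].

(** [C_R] *)
Definition route_cuts (R : realType) (C Om : finType) (X : set (vec R C))
  (Q : route C -> rat) (q : route C -> Om -> rat)
  (alpha : route C -> vec R C) (beta : route C -> R) :
  set (ils_tuple R C Om) :=
  [set c : ils_tuple R C Om | exists r, c = ILS (scen q r) (X_eq X r) (Q r) (alpha r) (beta r)].

(** [F_R]; spelled out over routes in [F_routeE]. *)
Definition F_route (R : realType) (C Om : finType) (X : set (vec R C))
  (Q : route C -> rat) (q : route C -> Om -> rat)
  (alpha : route C -> vec R C) (beta : route C -> R) :
  set (vec R C * {ffun Om -> R}) :=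
  [set z : vec R C * {ffun Om -> R} |
           [/\ int_points X z.1, forall w, 0 <= z.2 w
             & forall c, route_cuts X Q q alpha beta c ->
                 satisfies_ils c z.1 z.2]].

Lemma F_routeE (R : realType) (C Om : finType) (X : set (vec R C))
    (Q : route C -> rat) (q : route C -> Om -> rat)
    (alpha : route C -> vec R C) (beta : route C -> R) x th :
  F_route X Q q alpha beta (x, th) <->
  [/\ int_points X x, forall w, 0 <= th w
    & forall r, ratr (Q r) * (dot (alpha r) x + beta r)
                  <= total th (scen q r)].
Proof.
split=> -[xX th0 cuts]; split=> //.
  move=> r; apply: (cuts (ILS (scen q r) (X_eq X r) (Q r) (alpha r) (beta r))).
  by exists r.
by move=> c [r ->]; apply: cuts.
Qed.

Lemma route_cuts_ils (R : realType) (C Om : finType) (X : set (vec R C))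
    (Q : route C -> rat) (q : route C -> Om -> rat)
    (alpha : route C -> vec R C) (beta : route C -> R) :
  recourse_function Q -> disaggregation X Q q ->
  (forall r, activation X (X_eq X r) (alpha r) (beta r)) ->
  forall c, route_cuts X Q q alpha beta c -> is_ils_cut X q c.
Proof.
move=> Q0 [q0 Qq] act c [r ->]; split=> //=; first by move=> x [].
split=> [|x [xX rx]]; first exact: Q0.
rewrite (Qq x r xX rx) (bigID (mem (scen q r))) /=.
rewrite [X in _ + X]big1 ?addr0 => [|w]; last first.
  by rewrite inE lt_neqAle q0 andbT negbK => /eqP.
by apply: ler_sum => w _; rewrite (bigD1 r) //= lerDl sumr_ge0.
Qed.

(* Main.v *)
Require Import Defs.
From mathcomp Require Import all_boot all_order all_algebra.
From mathcomp Require Import classical_sets reals.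

Set Implicit Arguments.
Unset Strict Implicit.
Unset Printing Implicit Defensive.

Import Order.TTheory GRing.Theory Num.Theory.

Local Open Scope ring_scope.

(** At an integer point [x] the activation functions switch on exactly the cuts
    of the routes of the plan of [x]; every other cut has a nonpositive
    right-hand side.  So the cuts at [x] only say that, for each route [r] of
    the plan, [theta] puts at least [Q r] on the scenarios [scen q r].

    Any nonnegative [theta] that dominates each [q r] pointwise meets these
    requirements ([F_route_dominating]).  Adding up the [q r] over the plan, and
    putting the remaining slack on one scenario, lifts every point of the
    epigraph ([epi_sub_proj]).  For the other inclusion, if the sets [scen q r]
    are disjoint, the active cuts can be added up without counting any scenario
    twice, which gives the full recourse ([proj_sub_epi]).  Conversely, the
    pointwise maximum of the [q r] is also dominating, and its total reaches the
    full recourse only if the maximum equals the sum in each scenario; two routes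
    sharing a scenario make the maximum strictly smaller there
    ([bigmax_lt_sum], [proj_sub_epi_disjoint]). *)

(** Each term leaves at least one of the two positive terms [f i], [f j] out, so
    it is smaller than the sum by at least that one. *)
Lemma bigmax_lt_sum (F : realDomainType) (I : finType) (P : {set I})
    (f : I -> F) (i j : I) :
  (forall k, 0 <= f k) -> i \in P -> j \in P -> i != j -> 0 < f i -> 0 < f j ->
  \big[Num.max/0]_(k in P) f k < \sum_(k in P) f k.
Proof.
move=> f0 iP jP ij fi fj.
have lt_sum k l : k \in P -> l \in P -> l != k -> 0 < f l ->
    f k < \sum_(m in P) f m.
  move=> kP lP lk fl; rewrite (bigD1 k) //= (bigD1 l) ?lP //= ltrDl.
  by rewrite ltr_wpDr // sumr_ge0.
have lt_all k : k \in P -> f k < \sum_(m in P) f m.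
  move=> kP; have [ki|ki] := eqVneq i k; last exact: (lt_sum k i).
  by apply: (lt_sum k j) => //; rewrite -ki eq_sym.
apply: bigmax_lt => //; exact: le_lt_trans (lt_all i iP).
Qed.

Lemma sum_disjoint_le (F : numDomainType) (I J : finType) (P : {set I})
    (B : I -> {set J}) (f : J -> F) :
  (forall j, 0 <= f j) ->
  (forall i i', i \in P -> i' \in P -> i != i' -> B i :&: B i' = finset.set0) ->
  \sum_(i in P) \sum_(j in B i) f j <= \sum_j f j.
Proof.
move=> f0 disj; rewrite (exchange_big_dep predT) //=.
apply: ler_sum => j _.
have [i /andP[iP ji]|none] := pickP [pred i | (i \in P) && (j \in B i)]; last first.
  by rewrite big_pred0.
rewrite (big_pred1 i) // => k /=; apply/idP/eqP => [/andP[kP jk]|->].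
  apply/eqP; apply/negPn/negP => ki.
  have : j \in B k :&: B i by rewrite inE jk.
  by rewrite (disj k i) // inE.
by rewrite iP.
Qed.

Section RouteCuts.

Variables (R : realType) (C Om : finType) (X : set (vec R C)).
Variables (Q : route C -> rat) (q : route C -> Om -> rat).
Hypothesis hq : disaggregation X Q q.

Lemma Q_scen x r : int_points X x -> r \in plan_of x ->
  Q r = \sum_(w in scen q r) q r w.
Proof.
case: hq => q0 Qq xX rx; rewrite (Qq x r xX rx) (bigID (mem (scen q r))) /=.
rewrite [X in _ + X]big1 ?addr0 // => w.
by rewrite inE lt_neqAle q0 andbT negbK => /eqP.
Qed.

Lemma recourse_scenarios x : int_points X x ->
  recourse Q x = \sum_w \sum_(r in plan_of x) q r w.
Proof.
move=> xX; rewrite exchange_big; apply: eq_bigr => r rx.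
by case: hq => _ Qq; exact: Qq xX rx.
Qed.

Variables (alpha : route C -> vec R C) (beta : route C -> R).
Hypothesis hQ : recourse_function Q.
Hypothesis hact : forall r, activation X (X_eq X r) (alpha r) (beta r).

(** The cut of a route outside the plan is implied by nonnegativity; the cut of
    a route of the plan reads [Q r <= total th (scen q r)], which holds
    scenario by scenario. *)
Lemma F_route_dominating x (th : {ffun Om -> R}) : int_points X x ->
  (forall w, 0 <= th w) ->
  (forall r w, r \in plan_of x -> ratr (q r w) <= th w) ->
  F_route X Q q alpha beta (x, th).
Proof.
move=> xX th0 dom; apply/F_routeE; split=> // r.
case: (hact r) => on off; case: (boolP (r \in plan_of x)) => [rx|rx].
  rewrite on ?mulr1; last by split.
  by rewrite (Q_scen xX rx) rmorph_sum /=; apply: ler_sum => w _; exact: dom.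
apply: (@le_trans _ _ 0); last by apply: sumr_ge0.
apply: mulr_ge0_le0; first by rewrite ler0q; exact: hQ.
by apply: off => // -[_]; apply/negP.
Qed.

Lemma epi_sub_proj : (0 < #|Om|)%N ->
  subset (epi Q X) (proj_rho (F_route X Q q alpha beta)).
Proof.
move=> /card_gt0P[w0 _] [x rho] [/= rhoQ xX].
have q0 := hq.1.
pose slack : R := rho - ratr (recourse Q x).
have slack0 : 0 <= slack by rewrite subr_ge0.
pose th : {ffun Om -> R} := [ffun w =>
  ratr (\sum_(r in plan_of x) q r w) + (if w == w0 then slack else 0)].
exists th => /=.
  under eq_bigr => w _ do rewrite ffunE.
  rewrite big_split /= -rmorph_sum /= -recourse_scenarios //.
  by rewrite -big_mkcond /= big_pred1_eq addrC subrK.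
have slackw w : 0 <= if w == w0 then slack else 0 by case: ifP.
apply: F_route_dominating => // [w|r w rx]; rewrite ffunE.
  by rewrite addr_ge0 // ler0q sumr_ge0.
rewrite ler_wpDr // ler_rat (bigD1 r) //= lerDl.
exact: sumr_ge0.
Qed.

Lemma proj_sub_epi : route_disjoint X q ->
  subset (proj_rho (F_route X Q q alpha beta)) (epi Q X).
Proof.
move=> disj [x rho] [th /= -> /F_routeE[xX th0 cuts]]; split=> //=.
have disjx r r' := disj x xX r r'.
apply: le_trans (sum_disjoint_le th0 disjx).
rewrite /recourse rmorph_sum /=; apply: ler_sum => r rx.
apply: le_trans (cuts r).
by rewrite (hact r).1 ?mulr1; last by split.
Qed.

(** Testing the inclusion on the pointwise maximum of the [q r] bounds the
    recourse by the total of that maximum, which a shared scenario would make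
    strictly smaller than the recourse. *)
Lemma proj_sub_epi_disjoint :
  subset (proj_rho (F_route X Q q alpha beta)) (epi Q X) -> route_disjoint X q.
Proof.
move=> sub x xX r r' rx r'x rr'; apply/setP => w; rewrite !inE.
apply/negP => /andP[qr qr'].
have q0 := hq.1.
pose peak v := \big[Num.max/0]_(s in plan_of x) q s v.
pose th : {ffun Om -> R} := [ffun v => ratr (peak v)].
have thF : F_route X Q q alpha beta (x, th).
  apply: F_route_dominating => // [v|s v sx]; rewrite ffunE.
    by rewrite ler0q; apply: bigmax_ge_id.
  by rewrite ler_rat; apply: (le_bigmax_cond _ (fun s => q s v)).
have [/= le_th _] : epi Q X (x, \sum_v th v) by apply: sub; exists th.
have : recourse Q x <= \sum_v peak v.
  rewrite -(ler_rat R) [leRHS]rmorph_sum /=.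
  by apply: le_trans le_th _; apply: ler_sum => v _; rewrite ffunE.
rewrite recourse_scenarios // leNgt => /negP; apply.
rewrite (bigD1 w) //= [X in _ < X](bigD1 w) //=.
apply: ltr_leD; first exact: (bigmax_lt_sum _ rx r'x).
apply: ler_sum => v _; apply: bigmax_le => [|s sx]; first exact: sumr_ge0.
by rewrite (bigD1 s) //= lerDl sumr_ge0.
Qed.

End RouteCuts.

Theorem theorem2
  (R : realType) (C Om : finType) (hOm : (0 < #|Om|)%N)
  (X : set (vec R C)) (hX : polytope X) (hXsub : subset X (@Xsub R C))
  (Q : route C -> rat) (hQ : recourse_function Q)
  (q : route C -> Om -> rat) (hq : disaggregation X Q q)
  (alpha : route C -> vec R C) (beta : route C -> R)
  (hact : forall r, activation X (X_eq X r) (alpha r) (beta r)) :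
  epi Q X = proj_rho (F_route X Q q alpha beta) <-> route_disjoint X q.
Proof.
split=> [eq_epi|disj].
  by apply: (proj_sub_epi_disjoint hq hQ hact); rewrite eq_epi.
apply/seteqP; split; [exact: epi_sub_proj | exact: proj_sub_epi].
Qed.
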